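(* In the FAPS algorithm (described in the context), at every iteration $k$ and for every $i=1,\dots,d$, with $X=X_i^{(k+1)}$ there holds $$\left(\beta_i\mathbf{P}_X+\mathbf{P}^\perp_XA_iA_i^\top\mathbf{P}_X+\mathbf{P}_XA_iA_i^\top\mathbf{P}^\perp_X\right)Z^{(k)}=Y_i^{(k)},$$ where, among the quantities in this equation, only $Z^{(k)},Y_i^{(k)}\in\mathbb{R}^{n\times p}$ are shared (between client $i$ and the center).
   Context: Setting: $A=[A_1\;\cdots\;A_d]\in\mathbb{R}^{n\times m}$ with $A_i\in\mathbb{R}^{n\times m_i}$, $m_1+\dots+m_d=m$, $n\le m$; $A_i$ is held privately by client $i$. $\mathcal{S}_{n,p}=\{X\in\mathbb{R}^{n\times p}\mid X^\top X=I_p\}$; for $X\in\mathcal{S}_{n,p}$, $\mathbf{P}_X=XX^\top$ and $\mathbf{P}^\perp_X=I_n-XX^\top$. $\mathbf{orth}(M)$ is the set of orthonormal bases of the range of $M$. $\|\cdot\|_{\mathrm F}$, $\|\cdot\|_2$ are the Frobenius and spectral norms. FAPS algorithm. Parameters: penalty parameters $\beta_i>0$, constants $c_1,c_1'>0$ and $\delta_i\in[0,1)$ (independent of the $\beta_i$). Start from $X_i^{(0)},Z^{(0)}\in\mathcal{S}_{n,p}$. For all $k\ge0$ set $W_i^{(k)}=-\mathbf{P}^\perp_{X_i^{(k)}}A_iA_i^\top X_i^{(k)}$ and $\Lambda_i^{(k)}=X_i^{(k)}(W_i^{(k)})^\top+W_i^{(k)}(X_i^{(k)})^\top$. With $H_i^{(k)}=A_iA_i^\top+\Lambda_i^{(k)}+\beta_i\mathbf{P}_{Z^{(k)}}$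 and $h_i^{(k)}(X)=-\frac12\mathrm{tr}(X^\top H_i^{(k)}X)$, client $i$ takes any $X_i^{(k+1)}\in\mathcal{S}_{n,p}$ satisfying $h_i^{(k)}(X_i^{(k)})-h_i^{(k)}(X_i^{(k+1)})\ge\frac{c_1}{c_1'\|A_i\|_2^2+\beta_i}\|\mathbf{P}^\perp_{X_i^{(k)}}H_i^{(k)}X_i^{(k)}\|_{\mathrm F}^2$ and $\|\mathbf{P}^\perp_{X_i^{(k+1)}}H_i^{(k)}X_i^{(k+1)}\|_{\mathrm F}\le\delta_i\|\mathbf{P}^\perp_{X_i^{(k)}}H_i^{(k)}X_i^{(k)}\|_{\mathrm F}$. Then client $i$ computes $Y_i^{(k)}=Q_i^{(k)}Z^{(k)}$ with $Q_i^{(k)}=\beta_i\mathbf{P}_{X_i^{(k+1)}}-\Lambda_i^{(k+1)}$ and sends it to the center, which takes $Z^{(k+1)}\in\mathcal{S}_{n,p}$ with $Z^{(k+1)}\in\mathbf{orth}(\sum_{i=1}^dY_i^{(k)})$ and sends it to all clients. *)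

(* Defs.v *)
From mathcomp Require Import all_boot all_order all_algebra.
From mathcomp Require Import all_classical all_reals.

Set Implicit Arguments.
Unset Strict Implicit.
Unset Printing Implicit Defensive.

Import Order.TTheory GRing.Theory Num.Theory.
Local Open Scope ring_scope.

Section Matrices.
Variable R : realType.

Definition frob (m n : nat) (M : 'M[R]_(m, n)) : R :=
  Num.sqrt (\sum_i \sum_j M i j ^+ 2).

(* On column vectors [frob] is the Euclidean norm, so this is the operator
   norm induced by the Euclidean norms. *)
Definition specnorm (m n : nat) (M : 'M[R]_(m, n)) : R :=
  sup [set frob (M *m x) | x in [set x : 'cV[R]_n | frob x <= 1]].

Definition stiefel (n p : nat) (X : 'M[R]_(n, p)) : Prop := X^T *m X = 1%:M.

Definition oproj (n p : nat) (X : 'M[R]_(n, p)) : 'M[R]_n := X *m X^T.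

Definition oprojC (n p : nat) (X : 'M[R]_(n, p)) : 'M[R]_n :=
  1%:M - X *m X^T.

(* [U] is an orthonormal basis of the range (column space) of [M]; MathComp
   compares row spaces, hence the transposes. *)
Definition orth (n q r : nat) (M : 'M[R]_(n, q)) (U : 'M[R]_(n, r)) : Prop :=
  U^T *m U = 1%:M /\ (U^T == M^T)%MS.

End Matrices.

Section FAPS.
Variables (R : realType) (n p d : nat) (m_ : 'I_d -> nat).
Variable A : 'M[R]_(n, (\sum_i m_ i)%N).
Variables (beta delta : 'I_d -> R) (c1 c1' : R).

Definition gram (i : 'I_d) : 'M[R]_n := submxrow A i *m (submxrow A i)^T.

Definition faps_W (i : 'I_d) (X : 'M[R]_(n, p)) : 'M[R]_(n, p) :=
  - (oprojC X *m gram i *m X).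

Definition faps_Lambda (i : 'I_d) (X : 'M[R]_(n, p)) : 'M[R]_n :=
  X *m (faps_W i X)^T + faps_W i X *m X^T.

Definition faps_H (i : 'I_d) (X Z : 'M[R]_(n, p)) : 'M[R]_n :=
  gram i + faps_Lambda i X + beta i *: oproj Z.

Definition faps_h (i : 'I_d) (X Z V : 'M[R]_(n, p)) : R :=
  - (2^-1 * \tr (V^T *m faps_H i X Z *m V)).

Definition faps_Q (i : 'I_d) (X : 'M[R]_(n, p)) : 'M[R]_n :=
  beta i *: oproj X - faps_Lambda i X.

(* [Xnext] is an admissible outcome of the inexact local solve of client [i]
   from the iterates [X] and [Z]. *)
Definition local_update (i : 'I_d) (X Z Xnext : 'M[R]_(n, p)) : Prop :=
  let H := faps_H i X Z in
  let h := faps_h i X Z in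
  [/\ stiefel Xnext,
      h X - h Xnext >=
        c1 / (c1' * specnorm (submxrow A i) ^+ 2 + beta i)
          * frob (oprojC X *m H *m X) ^+ 2
    & frob (oprojC Xnext *m H *m Xnext) <=
        delta i * frob (oprojC X *m H *m X)].

Definition client_step (X Y : 'I_d -> nat -> 'M[R]_(n, p))
    (Z : nat -> 'M[R]_(n, p)) (k : nat) (i : 'I_d) : Prop :=
  local_update i (X i k) (Z k) (X i k.+1) /\
  Y i k = faps_Q i (X i k.+1) *m Z k.

Definition center_step (Y : 'I_d -> nat -> 'M[R]_(n, p))
    (Z : nat -> 'M[R]_(n, p)) (k : nat) : Prop :=
  stiefel (Z k.+1) /\ orth (\sum_i Y i k) (Z k.+1).

(* A run up to and including the client phase of iteration [K].  The horizon
   is finite because the center step of some iteration may have no solution: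
   it requires the sum of the [Y i k] to have rank [p]. *)
Definition faps_run (X Y : 'I_d -> nat -> 'M[R]_(n, p))
    (Z : nat -> 'M[R]_(n, p)) (K : nat) : Prop :=
  [/\ forall i, stiefel (X i 0%N),
      stiefel (Z 0%N),
      forall k, (k <= K)%N -> forall i, client_step X Y Z k i
    & forall k, (k < K)%N -> center_step Y Z k].

End FAPS.

(* Being shared is a property of the quantities named in the protocol, not of
   their values: a private matrix may happen to equal a transmitted one.  The
   messages are therefore described on formal names. *)
Section Communication.
Variable d : nat.

Inductive party : Type := Center | Client of 'I_d.

Inductive quantity : Type :=
| QData of 'I_d               (* A_i *)
| QPenalty of 'I_d            (* beta_i *)
| QX of 'I_d & nat            (* X_i^(k) *)
| QY of 'I_d & nat            (* Y_i^(k) *)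
| QZ of nat                   (* Z^(k) *)
| QGram of quantity           (* M M^T *)
| QProj of quantity           (* P_M *)
| QProjC of quantity.         (* I - P_M *)

(* The common starting point Z^(0) counts as sent by the center. *)
Inductive sent : party -> party -> quantity -> Prop :=
| sent_Y (i : 'I_d) (k : nat) : sent (Client i) Center (QY i k)
| sent_Z (i : 'I_d) (k : nat) : sent Center (Client i) (QZ k).

Definition shared (i : 'I_d) (q : quantity) : Prop :=
  sent (Client i) Center q \/ sent Center (Client i) q.

(* The quantities entering, with X = X_i^(k+1),
   (beta_i P_X + (I - P_X) A_i A_i^T P_X + P_X A_i A_i^T (I - P_X)) Z^(k)
     = Y_i^(k). *)
Inductive in_equation (i : 'I_d) (k : nat) : quantity -> Prop :=
| in_penalty : in_equation i k (QPenalty i)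
| in_X : in_equation i k (QX i k.+1)
| in_proj : in_equation i k (QProj (QX i k.+1))
| in_projC : in_equation i k (QProjC (QX i k.+1))
| in_data : in_equation i k (QData i)
| in_gram : in_equation i k (QGram (QData i))
| in_Z : in_equation i k (QZ k)
| in_Y : in_equation i k (QY i k).

End Communication.

(* Main.v *)
Require Import Defs.
From mathcomp Require Import all_boot all_order all_algebra.
From mathcomp Require Import all_classical all_reals.

Set Implicit Arguments.
Unset Strict Implicit.
Unset Printing Implicit Defensive.

Import Order.TTheory GRing.Theory Num.Theory.
Local Open Scope ring_scope.

(** The client forms [Y i k] as [faps_Q] at [X i k.+1] times [Z k], so the equation reduces to an
    identity between matrices. The Gram matrix and [oprojC X] are symmetric, so transposing [faps_W]
    turns the multiplier into minus the sum of the two cross terms between the projector and its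
    complement ([faps_LambdaE]); its minus sign in [faps_Q] makes them positive. Sharing is decided
    on formal names by the two kinds of message ([shared_in_equation]). *)

Lemma faps_LambdaE (R : realType) (n p d : nat) (m_ : 'I_d -> nat)
    (A : 'M[R]_(n, (\sum_i m_ i)%N)) (i : 'I_d) (X : 'M[R]_(n, p)) :
  faps_Lambda A i X =
    - (oprojC X *m gram A i *m oproj X + oproj X *m gram A i *m oprojC X).
Proof.
have tr_gram : (gram A i)^T = gram A i by rewrite trmx_mul trmxK.
have tr_oprojC : (oprojC X)^T = oprojC X.
  by rewrite linearB /= trmx1 trmx_mul trmxK.
rewrite /faps_Lambda /faps_W linearN /= 2!trmx_mul tr_gram tr_oprojC.
(* The summand [X *m (faps_W i X)^T] yields the cross term with [oprojC X] on the right, so the two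
   terms are swapped. *)
by rewrite mulmxN mulNmx -opprD addrC /oproj !mulmxA.
Qed.

(** Messages carry only names built with [QY] or [QZ]; [in_equation] fixes their iteration to [k],
    as client [i] shares such names for every iteration. *)
Lemma shared_in_equation (d : nat) (i : 'I_d) (k : nat) (q : quantity d) :
  in_equation i k q -> (shared i q <-> q = QZ d k \/ q = QY i k).
Proof.
move=> q_in; split; last first.
  by case=> ->; [right; exact: sent_Z | left; exact: sent_Y].
(* Of the eight names times two directions, only [QY] sent upward and [QZ] sent downward survive the
   inversion. *)
by case: q_in => -[] H; inversion H; by [left | right].
Qed.

Theorem proposition5 (R : realType) (n p d : nat) (m_ : 'I_d -> nat)
    (A : 'M[R]_(n, (\sum_i m_ i)%N)) (beta delta : 'I_d -> R) (c1 c1' : R)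
    (X Y : 'I_d -> nat -> 'M[R]_(n, p)) (Z : nat -> 'M[R]_(n, p)) (K : nat)
    (n_le_m : (n <= \sum_i m_ i)%N)
    (beta_gt0 : forall i, 0 < beta i)
    (c1_gt0 : 0 < c1) (c1'_gt0 : 0 < c1')
    (delta_bnd : forall i, 0 <= delta i < 1)
    (run : faps_run A beta delta c1 c1' X Y Z K)
    (k : nat) (k_le_K : (k <= K)%N) (i : 'I_d) :
  (let Ai := submxrow A i in
   let PX := oproj (X i k.+1) in
   let PXC := oprojC (X i k.+1) in
   (beta i *: PX + PXC *m (Ai *m Ai^T) *m PX + PX *m (Ai *m Ai^T) *m PXC)
      *m Z k
     = Y i k)
  /\ (forall q : quantity d, in_equation i k q ->
        (shared i q <-> q = QZ d k \/ q = QY i k)).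
Proof.
split; last by move=> q; apply: shared_in_equation.
have [_ _ /(_ k k_le_K i)[_ ->] _] := run.
by rewrite /faps_Q faps_LambdaE opprK addrA.
Qed.
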